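(* Every proof of a sequent in $\mathcal{G}$ can be reduced to a W-normal proof of the same sequent having the same degree.
   Context: Formulae are built from propositional variables and $\bot$ with the binary connectives $\wedge,\vee,\rightarrow$. Sequents have the form $\Gamma \vdash C$, $\Gamma$ a finite (possibly empty) sequence of formulae, $C$ a formula. The system $\mathcal{G}$ (for intuitionistic propositional logic) has axioms $A \vdash A$ and $\bot \vdash A$ and rules: (C) from $\Delta, A, B, \Gamma \vdash C$ infer $\Delta, B, A, \Gamma \vdash C$; (W) from $\Theta, A, A, \Gamma \vdash C$ infer $\Theta, A, \Gamma \vdash C$; (K) from $\Theta, \Gamma \vdash C$ infer $\Theta, A, \Gamma \vdash C$; (cut) from $\Delta \vdash A$ and $\Theta, A, \Gamma \vdash C$ infer $\Theta, \Delta, \Gamma \vdash C$ ($A$ is the cut formula); ($\wedge$L) from $\Theta, A, \Gamma \vdash C$ (resp. $\Theta, B, \Gamma \vdash C$) infer $\Theta, A\wedge B, \Gamma \vdash C$; ($\wedge$R) from $\Gamma \vdash A$ and $\Gamma \vdash B$ infer $\Gamma \vdash A \wedge B$; ($\vee$L) from $\Theta, A, \Gamma \vdash C$ and $\Theta, B, \Gamma \vdash C$ infer $\Theta, A \vee B, \Gamma \vdash C$; ($\vee$R) from $\Gamma \vdash A$ (resp. $\Gamma \vdash B$) infer $\Gamma \vdash A \vee B$; ($\rightarrow$L) from $\Delta \vdash A$ and $\Theta, B, \Gamma \vdash C$ infer $\Theta, \Delta, A \rightarrow B, \Gamma \vdash C$; ($\rightarrow$R) from $A, \Gamma \vdash B$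 infer $\Gamma \vdash A \rightarrow B$. The degree of a cut is the number of binary connectives in its cut formula; the degree of a proof is the maximal degree of its cuts (0 if none). A proof is W-normal iff every application of (W) in it either is the last rule of the proof, or has only applications of (W) below it, or is the upper rule in one of the two contexts: (i) $\Theta, A, A, A, \Gamma \vdash C$ by (W) to $\Theta, A, A, \Gamma \vdash C$ followed by (W) to $\Theta, A, \Gamma \vdash C$; (ii) $A, A, \Gamma \vdash B$ by (W) to $A, \Gamma \vdash B$ followed by ($\rightarrow$R) to $\Gamma \vdash A \rightarrow B$. *)

(* Defs.v *)
From Stdlib Require Import List.
Import ListNotations.

Set Implicit Arguments.
Unset Strict Implicit.

Declare Scope gentzen_scope.
Open Scope list_scope.
Open Scope gentzen_scope.

Inductive form (V : Type) : Type :=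
| Var : V -> form V
| Bot : form V
| And : form V -> form V -> form V
| Or  : form V -> form V -> form V
| Imp : form V -> form V -> form V.

Arguments Bot {V}.

Fixpoint connectives (V : Type) (A : form V) : nat :=
  match A with
  | Var _ | Bot => 0
  | And A1 A2 | Or A1 A2 | Imp A1 A2 => S (connectives A1 + connectives A2)
  end.

Record sequent (V : Type) : Type :=
  Sequent { antecedent : list (form V); succedent : form V }.

Notation "Γ ⊢ C" := (Sequent Γ C) (at level 70, no associativity) : gentzen_scope.

(* Proofs are trees, in [Type]: normality and degree depend on the tree, not
   only on provability. *)
Inductive proof (V : Type) : sequent V -> Type :=
| Ax A :
    proof ([A] ⊢ A)
| BotAx A :
    proof ([Bot] ⊢ A)
| C Δ A B Γ D :
    proof (Δ ++ A :: B :: Γ ⊢ D) ->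
    proof (Δ ++ B :: A :: Γ ⊢ D)
| W Θ A Γ D :
    proof (Θ ++ A :: A :: Γ ⊢ D) ->
    proof (Θ ++ A :: Γ ⊢ D)
| K Θ A Γ D :
    proof (Θ ++ Γ ⊢ D) ->
    proof (Θ ++ A :: Γ ⊢ D)
| Cut Δ A Θ Γ D :
    proof (Δ ⊢ A) ->
    proof (Θ ++ A :: Γ ⊢ D) ->
    proof (Θ ++ Δ ++ Γ ⊢ D)
| AndL1 Θ A B Γ D :
    proof (Θ ++ A :: Γ ⊢ D) ->
    proof (Θ ++ And A B :: Γ ⊢ D)
| AndL2 Θ A B Γ D :
    proof (Θ ++ B :: Γ ⊢ D) ->
    proof (Θ ++ And A B :: Γ ⊢ D)
| AndR Γ A B :
    proof (Γ ⊢ A) ->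
    proof (Γ ⊢ B) ->
    proof (Γ ⊢ And A B)
| OrL Θ A B Γ D :
    proof (Θ ++ A :: Γ ⊢ D) ->
    proof (Θ ++ B :: Γ ⊢ D) ->
    proof (Θ ++ Or A B :: Γ ⊢ D)
| OrR1 Γ A B :
    proof (Γ ⊢ A) ->
    proof (Γ ⊢ Or A B)
| OrR2 Γ A B :
    proof (Γ ⊢ B) ->
    proof (Γ ⊢ Or A B)
| ImpL Δ A B Θ Γ D :
    proof (Δ ⊢ A) ->
    proof (Θ ++ B :: Γ ⊢ D) ->
    proof (Θ ++ Δ ++ Imp A B :: Γ ⊢ D)
| ImpR A Γ B :
    proof (A :: Γ ⊢ B) ->
    proof (Γ ⊢ Imp A B).

Fixpoint degree (V : Type) (s : sequent V) (p : proof s) : nat :=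
  match p with
  | Ax _ | BotAx _ => 0
  | C p1 | W p1 | K _ p1 | AndL1 _ p1 | AndL2 _ p1
  | OrR1 _ p1 | OrR2 _ p1 | ImpR p1 => degree p1
  | @Cut _ _ A _ _ _ p1 p2 =>
      Nat.max (connectives A) (Nat.max (degree p1) (degree p2))
  | AndR p1 p2 | OrL p1 p2 | ImpL p1 p2 => Nat.max (degree p1) (degree p2)
  end.

(* A proof packed with its end sequent, so that the proofs of different
   sequents occurring in one tree can be listed together. *)
Definition packed (V : Type) : Type := {s : sequent V & proof s}.

Definition pack (V : Type) (s : sequent V) (p : proof s) : packed V :=
  existT (@proof V) s p.

Definition conclusion (V : Type) (P : packed V) : sequent V := projT1 P.

Definition immediate_subproofs (V : Type) (P : packed V) : list (packed V) :=
  match projT2 P with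
  | Ax _ | BotAx _ => []
  | C p1 | W p1 | K _ p1 | AndL1 _ p1 | AndL2 _ p1
  | OrR1 _ p1 | OrR2 _ p1 | ImpR p1 => [pack p1]
  | Cut p1 p2 | AndR p1 p2 | OrL p1 p2 | ImpL p1 p2 => [pack p1; pack p2]
  end.

Definition premises (V : Type) (P : packed V) : list (sequent V) :=
  map (@conclusion V) (immediate_subproofs P).

Definition ends_with_W (V : Type) (P : packed V) : Prop :=
  match projT2 P with W _ => True | _ => False end.

Definition ends_with_ImpR (V : Type) (P : packed V) : Prop :=
  match projT2 P with ImpR _ => True | _ => False end.

(* [occurs P below Q]: the subproof [Q] occurs in [P], and the rule
   applications below the last rule of [Q] are, from [Q] down to the root, the
   last rules of the subproofs listed in [below] (empty when [Q] is [P]).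
   A rule application of [P] is thus given by a pair [(below, Q)]. *)
Inductive occurs (V : Type) (P : packed V) :
  list (packed V) -> packed V -> Prop :=
| occurs_root : occurs P [] P
| occurs_up below Q R :
    occurs P below Q -> In R (immediate_subproofs Q) -> occurs P (Q :: below) R.

(* In both contexts [U] is the subproof ending with the upper rule and [L] the
   one ending with the lower rule, [U] being an immediate subproof of [L]. *)
Definition context_W_W (V : Type) (U L : packed V) : Prop :=
  exists Θ A Γ D,
    ends_with_W U /\ ends_with_W L /\
    premises U = [Θ ++ A :: A :: A :: Γ ⊢ D] /\
    conclusion U = (Θ ++ A :: A :: Γ ⊢ D) /\
    conclusion L = (Θ ++ A :: Γ ⊢ D).

Definition context_W_ImpR (V : Type) (U L : packed V) : Prop :=
  exists A Γ B,
    ends_with_W U /\ ends_with_ImpR L /\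
    premises U = [A :: A :: Γ ⊢ B] /\
    conclusion U = (A :: Γ ⊢ B) /\
    conclusion L = (Γ ⊢ Imp A B).

(* The first disjunct, with [below = []], covers the last rule of the proof. *)
Definition W_normal (V : Type) (s : sequent V) (p : proof s) : Prop :=
  forall below U, occurs (pack p) below U -> ends_with_W U ->
    (forall L, In L below -> ends_with_W L) \/
    (exists L below', below = L :: below' /\ (context_W_W U L \/ context_W_ImpR U L)).

(* Main.v *)
(** Contractions are pushed towards the root, at the price of making several
    copies of the antecedent: a proof of [Γ ⊢ C] becomes, for some [n], a proof
    of [Γ, ..., Γ ⊢ C] ([n] copies) in which the only contractions are those
    that merge the copies of [A] just before a right introduction of [Imp A B].
    A cut on [n] copies of the cut formula becomes [n] cuts on the same formula,
    so the degree does not grow.  For the left disjunction rule, if [k] copies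
    of [A], or [k] copies of [B], suffice, then [2k] copies of [Or A B] suffice,
    by the pigeonhole principle.  The copies are finally contracted at the
    root.  If cuts of maximal degree were lost, the degree is restored by a cut
    with a weakened provable formula. *)
From Stdlib Require Import List Permutation Lia.
Require Import Defs.
Import ListNotations.

Set Implicit Arguments.
Unset Strict Implicit.

Section Copies.
Variable T : Type.
Implicit Types l : list T.

Definition copies (n : nat) l : list T := concat (repeat l n).

Lemma copies_add m n l : copies (m + n) l = copies m l ++ copies n l.
Proof. unfold copies. now rewrite repeat_app, concat_app. Qed.

Lemma copies_mul m n l : copies m (copies n l) = copies (m * n) l.
Proof.
  induction m as [|m IH]; [reflexivity|].
  change (copies n l ++ copies m (copies n l) = copies (n + m * n) l).
  now rewrite IH, copies_add.
Qed.

Lemma copies_app n l l' :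
  Permutation (copies n (l ++ l')) (copies n l ++ copies n l').
Proof.
  induction n as [|n IH]; [apply perm_nil|].
  change (Permutation ((l ++ l') ++ copies n (l ++ l'))
            ((l ++ copies n l) ++ l' ++ copies n l')).
  rewrite IH, <- !app_assoc. apply Permutation_app_head, Permutation_app_swap_app.
Qed.

Lemma copies_perm n l l' :
  Permutation l l' -> Permutation (copies n l) (copies n l').
Proof.
  intros H. induction n as [|n IH]; [apply perm_nil|].
  now apply Permutation_app.
Qed.

Lemma copies_middle n l a l' :
  Permutation (copies n (l ++ a :: l')) (copies n [a] ++ copies n (l ++ l')).
Proof.
  rewrite <- (copies_app n [a]). apply copies_perm. symmetry.
  exact (Permutation_middle l l' a).
Qed.

Lemma copies_flat_map n l :
  Permutation (copies n l) (flat_map (fun a => copies n [a]) l).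
Proof.
  induction l as [|a l IH]; simpl.
  - induction n as [|n IH]; [apply perm_nil|exact IH].
  - now rewrite <- IH, (copies_app n [a] l).
Qed.

End Copies.

Section Normalization.
Variable V : Type.
Implicit Types (P U : packed V) (Γ Δ Θ : list (form V)) (A B D : form V).

Lemma occurs_cases P below U :
  occurs P below U ->
  (below = [] /\ U = P) \/
  exists R below', In R (immediate_subproofs P) /\ occurs R below' U /\
    below = below' ++ [P].
Proof.
  induction 1 as [|below Q U H IH HU]; [now left|]. right.
  destruct IH as [[-> ->]|(R & below' & HR & HQ & ->)].
  - exists U, []. repeat split; [exact HU|constructor].
  - exists R, (Q :: below'). repeat split; [exact HR|].
    now apply occurs_up with (Q := Q).
Qed.

Definition in_context (below : list (packed V)) U : Prop :=
  exists L below', below = L :: below' /\ (context_W_W U L \/ context_W_ImpR U L).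

Lemma in_context_app below below' U :
  in_context below U -> in_context (below ++ below') U.
Proof.
  intros (L & b & -> & H). exists L, (b ++ below'). now split.
Qed.

Definition confined P : Prop :=
  forall below U, occurs P below U -> ends_with_W U -> in_context below U.

(* The last rule may moreover contract the first formula. *)
Definition head_confined P : Prop :=
  forall below U, occurs P below U -> ends_with_W U ->
    in_context below U \/
    (below = [] /\ U = P /\ exists A Γ D,
      premises P = [A :: A :: Γ ⊢ D] /\ conclusion P = (A :: Γ ⊢ D)).

Lemma confined_rule P :
  ~ ends_with_W P ->
  (forall R, In R (immediate_subproofs P) -> confined R) -> confined P.
Proof.
  intros HP HR below U HU HW.
  destruct (occurs_cases HU) as [[_ ->]|(R & b & Hin & HRU & ->)]; [easy|].
  apply in_context_app. now apply (HR R Hin).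
Qed.

Lemma head_confined_W A Γ D (q : proof (A :: A :: Γ ⊢ D)) :
  head_confined (pack q) -> head_confined (pack (@W V [] A Γ D q)).
Proof.
  intros Hq below U HU HW.
  destruct (occurs_cases HU) as [[-> ->]|(R & b & [<-|[]] & HRU & ->)].
  - right. repeat split. now exists A, Γ, D.
  - left. destruct (Hq _ _ HRU HW) as [H|(-> & -> & A' & Γ' & D' & Hprem & Hc)].
    + now apply in_context_app.
    + unfold conclusion in Hc. simpl in Hc. injection Hc as <- <- <-.
      exists (pack (@W V [] A Γ D q)), []. split; [reflexivity|]. left.
      exists [], A, Γ, D. now repeat split.
Qed.

Lemma confined_ImpR A Γ D (q : proof (A :: Γ ⊢ D)) :
  head_confined (pack q) -> confined (pack (ImpR q)).
Proof.
  intros Hq below U HU HW.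
  destruct (occurs_cases HU) as [[-> ->]|(R & b & [<-|[]] & HRU & ->)]; [easy|].
  destruct (Hq _ _ HRU HW) as [H|(-> & -> & A' & Γ' & D' & Hprem & Hc)].
  - now apply in_context_app.
  - unfold conclusion in Hc. simpl in Hc. injection Hc as <- <- <-.
    exists (pack (ImpR q)), []. split; [reflexivity|]. right.
    exists A, Γ, D. now repeat split.
Qed.

Lemma W_normal_confined s (q : proof s) : confined (pack q) -> W_normal q.
Proof. intros Hq below U HU HW. right. now apply Hq. Qed.

Lemma W_normal_W Θ A Γ D (q : proof (Θ ++ A :: A :: Γ ⊢ D)) :
  W_normal q -> W_normal (W q).
Proof.
  intros Hq below U HU HW.
  destruct (occurs_cases HU) as [[-> ->]|(R & b & [<-|[]] & HRU & ->)].
  - left. easy.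
  - destruct (Hq _ _ HRU HW) as [H|H].
    + left. intros L HL. apply in_app_or in HL as [HL|[<-|[]]]; [now apply H|exact I].
    + right. now apply in_context_app.
Qed.

Definition derivable (d : nat) Γ D : Prop :=
  exists q : proof (Γ ⊢ D), confined (pack q) /\ degree q <= d.

Ltac by_rule r :=
  exists r; split;
  [ apply confined_rule; [now intros []|];
    simpl; intros ? HR; repeat (destruct HR as [<-|HR]; [assumption|]); destruct HR
  | simpl; lia ].

Lemma derivable_le d d' Γ D : d <= d' -> derivable d Γ D -> derivable d' Γ D.
Proof. intros H (q & Hq & Hd). exists q. split; [exact Hq|lia]. Qed.

Lemma derivable_Ax d A : derivable d [A] A.
Proof. by_rule (Ax A). Qed.

Lemma derivable_BotAx d A : derivable d [Bot] A.
Proof. by_rule (BotAx A). Qed.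

Lemma derivable_perm d Γ Γ' D :
  Permutation Γ Γ' -> derivable d Γ D -> derivable d Γ' D.
Proof.
  intros H. change (derivable d ([] ++ Γ) D -> derivable d ([] ++ Γ') D).
  generalize (@nil (form V)).
  induction H as [|A Γ Γ' _ IH|A B Γ|Γ Γ' Γ'' _ IH1 _ IH2]; intros Δ.
  - easy.
  - specialize (IH (Δ ++ [A])). now rewrite <- !app_assoc in IH.
  - intros (q & Hq & Hd). by_rule (C q).
  - intros H. now apply IH2, IH1.
Qed.

Lemma derivable_weaken d Δ Γ D : derivable d Γ D -> derivable d (Δ ++ Γ) D.
Proof.
  intros H. induction Δ as [|A Δ (q & Hq & Hd)]; [exact H|].
  by_rule (@K V [] A (Δ ++ Γ) D q).
Qed.

Lemma derivable_Cut d Δ A Γ D :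
  connectives A <= d -> derivable d Δ A -> derivable d (A :: Γ) D ->
  derivable d (Δ ++ Γ) D.
Proof.
  intros HA (q & Hq & Hd) (r & Hr & He). by_rule (@Cut V Δ A [] Γ D q r).
Qed.

Lemma derivable_AndL1 d A B Γ D :
  derivable d (A :: Γ) D -> derivable d (And A B :: Γ) D.
Proof. intros (q & Hq & Hd). by_rule (@AndL1 V [] A B Γ D q). Qed.

Lemma derivable_AndL2 d A B Γ D :
  derivable d (B :: Γ) D -> derivable d (And A B :: Γ) D.
Proof. intros (q & Hq & Hd). by_rule (@AndL2 V [] A B Γ D q). Qed.

Lemma derivable_AndR d Γ A B :
  derivable d Γ A -> derivable d Γ B -> derivable d Γ (And A B).
Proof. intros (q & Hq & Hd) (r & Hr & He). by_rule (AndR q r). Qed.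

Lemma derivable_OrL d A B Γ D :
  derivable d (A :: Γ) D -> derivable d (B :: Γ) D ->
  derivable d (Or A B :: Γ) D.
Proof.
  intros (q & Hq & Hd) (r & Hr & He). by_rule (@OrL V [] A B Γ D q r).
Qed.

Lemma derivable_OrR1 d Γ A B : derivable d Γ A -> derivable d Γ (Or A B).
Proof. intros (q & Hq & Hd). by_rule (OrR1 B q). Qed.

Lemma derivable_OrR2 d Γ A B : derivable d Γ B -> derivable d Γ (Or A B).
Proof. intros (q & Hq & Hd). by_rule (OrR2 A q). Qed.

Lemma derivable_ImpL d Δ A B Γ D :
  derivable d Δ A -> derivable d (B :: Γ) D ->
  derivable d (Δ ++ Imp A B :: Γ) D.
Proof.
  intros (q & Hq & Hd) (r & Hr & He). by_rule (@ImpL V Δ A B [] Γ D q r).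
Qed.

Lemma derivable_ImpR_copies d n A Γ B :
  derivable d (copies (S n) [A] ++ Γ) B -> derivable d Γ (Imp A B).
Proof.
  intros (q & Hq & Hd).
  assert (H : exists r : proof (A :: Γ ⊢ B),
            head_confined (pack r) /\ degree r <= d).
  { assert (Hq' : head_confined (pack q)) by (intros b U HU HW; left; now apply Hq).
    clear Hq. induction n as [|n IH]; [now exists q|].
    apply (IH (@W V [] A (copies n [A] ++ Γ) B q)); [exact Hd|].
    now apply head_confined_W. }
  destruct H as (r & Hr & He). exists (ImpR r). split; [now apply confined_ImpR|easy].
Qed.

Lemma derivable_copies_le d m n Γ D :
  m <= n -> derivable d (copies m Γ) D -> derivable d (copies n Γ) D.
Proof.
  intros H HD. replace n with ((n - m) + m) by lia.
  rewrite copies_add. now apply derivable_weaken.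
Qed.

Lemma derivable_replace_copies d A Δ D :
  (forall Γ, derivable d (A :: Γ) D -> derivable d (Δ ++ Γ) D) ->
  forall n Γ, derivable d (copies n [A] ++ Γ) D -> derivable d (copies n Δ ++ Γ) D.
Proof.
  intros H n. induction n as [|n IH]; intros Γ HD; [exact HD|].
  apply H in HD.
  eapply derivable_perm in HD; [|apply Permutation_app_swap_app].
  apply IH in HD. eapply derivable_perm; [|exact HD].
  change (Permutation (copies n Δ ++ Δ ++ Γ) ((Δ ++ copies n Δ) ++ Γ)).
  rewrite <- app_assoc. apply Permutation_app_swap_app.
Qed.

(* Among [i + j + c >= 2k] disjuncts eventually chosen, [k] are equal. *)
Lemma derivable_OrL_copies d A B Γ D k :
  derivable d (copies k [A] ++ Γ) D -> derivable d (copies k [B] ++ Γ) D ->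
  forall c i j, 2 * k <= i + j + c ->
  derivable d (copies c [Or A B] ++ copies i [A] ++ copies j [B] ++ Γ) D.
Proof.
  intros HA HB c. induction c as [|c IH]; intros i j H.
  - destruct (PeanoNat.Nat.le_gt_cases k i) as [Hi|Hi].
    + replace i with ((i - k) + k) by lia. rewrite copies_add.
      apply derivable_perm with
        (Γ := (copies (i - k) [A] ++ copies j [B]) ++ copies k [A] ++ Γ).
      * simpl. rewrite <- !app_assoc. apply Permutation_app_head.
        apply Permutation_app_swap_app.
      * now apply derivable_weaken.
    + replace j with ((j - k) + k) by lia. rewrite copies_add.
      simpl. rewrite <- app_assoc. now do 2 apply derivable_weaken.
  - apply derivable_OrL.
    + eapply derivable_perm; [|apply (IH (S i) j); lia].
      symmetry.
      exact (Permutation_middle (copies c [Or A B]) (copies i [A] ++ copies j [B] ++ Γ) A).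
    + eapply derivable_perm; [|apply (IH i (S j)); lia].
      change (Permutation
        (copies c [Or A B] ++ copies i [A] ++ B :: copies j [B] ++ Γ)
        (B :: copies c [Or A B] ++ copies i [A] ++ copies j [B] ++ Γ)).
      rewrite !app_assoc. symmetry. rewrite <- app_assoc.
      rewrite <- Permutation_middle, <- !app_assoc. reflexivity.
Qed.

Lemma derivable_left_copies d A n Δ k Θ Γ D :
  1 <= k ->
  (forall Γ', derivable d (A :: Γ') D -> derivable d (copies k Δ ++ Γ') D) ->
  derivable d (copies n (Θ ++ A :: Γ)) D ->
  derivable d (copies (n * k) (Θ ++ Δ ++ Γ)) D.
Proof.
  intros Hk H HD.
  eapply derivable_perm in HD; [|apply copies_middle].
  apply (derivable_replace_copies H) in HD. rewrite copies_mul in HD.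
  apply derivable_perm with
    (Γ := copies (n * k - n) (Θ ++ Γ) ++ copies (n * k) Δ ++ copies n (Θ ++ Γ)).
  - rewrite Permutation_app_swap_app, <- copies_add.
    replace (n * k - n + n) with (n * k) by nia.
    rewrite <- copies_app. apply copies_perm, Permutation_app_swap_app.
  - now apply derivable_weaken.
Qed.

Lemma derivable_copies s (p : proof s) :
  exists n, 1 <= n /\
    derivable (degree p) (copies n (antecedent s)) (succedent s).
Proof.
  induction p as
    [A|A|Δ A B Γ D p (n & Hn & IH)|Θ A Γ D p (n & Hn & IH)
    |Θ A Γ D p (n & Hn & IH)
    |Δ A Θ Γ D p (m & Hm & IHp) q (n & Hn & IHq)
    |Θ A B Γ D p (n & Hn & IH)|Θ A B Γ D p (n & Hn & IH)
    |Γ A B p (m & Hm & IHp) q (n & Hn & IHq)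
    |Θ A B Γ D p (m & Hm & IHp) q (n & Hn & IHq)
    |Γ A B p (n & Hn & IH)|Γ A B p (n & Hn & IH)
    |Δ A B Θ Γ D p (m & Hm & IHp) q (n & Hn & IHq)
    |A Γ B p (n & Hn & IH)]; simpl in *.
  - exists 1. split; [easy|apply derivable_Ax].
  - exists 1. split; [easy|apply derivable_BotAx].
  - exists n. split; [easy|]. eapply derivable_perm; [|exact IH].
    apply copies_perm, Permutation_app_head, perm_swap.
  - exists (n * 2). split; [lia|].
    apply derivable_perm with (Γ := copies n (Θ ++ Γ) ++ copies n (Θ ++ A :: A :: Γ)).
    + rewrite <- copies_app, <- copies_mul. apply copies_perm.
      rewrite copies_middle.
      change (copies 2 [A]) with ([A] ++ [A]).
      change (copies 2 (Θ ++ Γ)) with ((Θ ++ Γ) ++ (Θ ++ Γ) ++ []).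
      rewrite app_nil_r, (Permutation_app_swap_app ([A] ++ [A])). apply Permutation_app_head.
      rewrite <- (Permutation_middle Θ (A :: Γ)), <- (Permutation_middle Θ Γ).
      reflexivity.
    + now apply derivable_weaken.
  - exists n. split; [easy|]. eapply derivable_perm; [symmetry; apply copies_middle|].
    now apply derivable_weaken.
  - exists (n * m). split; [nia|].
    apply derivable_left_copies with (A := A); [easy| |].
    + intros Γ'. apply derivable_Cut; [lia|].
      eapply derivable_le; [|exact IHp]. lia.
    + eapply derivable_le; [|exact IHq]. lia.
  - exists (n * 1). split; [lia|].
    apply (@derivable_left_copies _ A _ [And A B]); [easy| |exact IH].
    intros Γ'. apply derivable_AndL1.
  - exists (n * 1). split; [lia|].
    apply (@derivable_left_copies _ B _ [And A B]); [easy| |exact IH].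
    intros Γ'. apply derivable_AndL2.
  - exists (m + n). split; [lia|]. apply derivable_AndR.
    + apply derivable_copies_le with (m := m); [lia|].
      eapply derivable_le; [|exact IHp]. lia.
    + apply derivable_copies_le with (m := n); [lia|].
      eapply derivable_le; [|exact IHq]. lia.
  - set (d := Nat.max (degree p) (degree q)). exists (2 * (m + n)). split; [lia|].
    assert (HA : derivable d (copies (m + n) [A] ++ copies (m + n) (Θ ++ Γ)) D).
    { eapply derivable_perm; [apply copies_middle|].
      apply derivable_copies_le with (m := m); [lia|].
      eapply derivable_le; [|exact IHp]. lia. }
    assert (HB : derivable d (copies (m + n) [B] ++ copies (m + n) (Θ ++ Γ)) D).
    { eapply derivable_perm; [apply copies_middle|].
      apply derivable_copies_le with (m := n); [lia|].
      eapply derivable_le; [|exact IHq]. lia. }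
    assert (H : 2 * (m + n) <= 0 + 0 + 2 * (m + n)) by lia.
    apply (derivable_OrL_copies HA HB) in H.
    apply (derivable_weaken (copies (m + n) (Θ ++ Γ))) in H.
    eapply derivable_perm; [|exact H].
    rewrite copies_middle, Permutation_app_swap_app.
    apply Permutation_app_head. simpl.
    rewrite <- copies_add. now rewrite PeanoNat.Nat.add_0_r.
  - exists n. split; [easy|]. now apply derivable_OrR1.
  - exists n. split; [easy|]. now apply derivable_OrR2.
  - exists (n * m). split; [nia|].
    replace (Θ ++ Δ ++ Imp A B :: Γ) with (Θ ++ (Δ ++ [Imp A B]) ++ Γ)
      by now rewrite <- app_assoc.
    apply derivable_left_copies with (A := B); [easy| |].
    + intros Γ' H.
      assert (HI : derivable (Nat.max (degree p) (degree q))
                     (copies m Δ ++ Imp A B :: Γ') D).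
      { apply derivable_ImpL; [|exact H]. eapply derivable_le; [|exact IHp]. lia. }
      apply (derivable_weaken (copies (m - 1) [Imp A B])) in HI.
      eapply derivable_perm; [|exact HI].
      rewrite copies_app, Permutation_app_swap_app, <- app_assoc.
      apply Permutation_app_head.
      change (Imp A B :: Γ') with (copies 1 [Imp A B] ++ Γ').
      rewrite app_assoc, <- copies_add. now replace (m - 1 + 1) with m by lia.
    + eapply derivable_le; [|exact IHq]. lia.
  - exists n. split; [easy|]. destruct n as [|n]; [lia|].
    apply derivable_ImpR_copies with (n := n).
    eapply derivable_perm; [|exact IH]. apply (copies_app (S n) [A] Γ).
Qed.

Fixpoint provable_of_degree (n : nat) : form V :=
  match n with
  | 0 => Bot
  | S n => Imp Bot (provable_of_degree n)
  end.

Lemma connectives_provable_of_degree n : connectives (provable_of_degree n) = n.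
Proof. induction n; simpl; congruence. Qed.

Lemma derivable_exact_degree d Γ D :
  derivable d Γ D -> exists q : proof (Γ ⊢ D), confined (pack q) /\ degree q = d.
Proof.
  intros (q & Hq & Hd). destruct d as [|d].
  { exists q. split; [exact Hq|lia]. }
  set (A := provable_of_degree (S d)).
  assert (HA : connectives A = S d) by apply connectives_provable_of_degree.
  assert (HT : derivable 0 [] A).
  { apply (@derivable_ImpR_copies _ 0). apply derivable_BotAx. }
  destruct HT as (t & Ht & Hdt).
  assert (HK : confined (pack (@K V [] A Γ D q))).
  { apply confined_rule; [easy|]. now intros ? [<-|[]]. }
  exists (@Cut V [] A [] Γ D t (@K V [] A Γ D q)). split.
  - apply confined_rule; [easy|]. now intros ? [<-|[<-|[]]].
  - change (Nat.max (connectives A) (Nat.max (degree t) (degree q)) = S d). lia.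
Qed.

Definition W_normalizable (d : nat) Γ D : Prop :=
  exists q : proof (Γ ⊢ D), W_normal q /\ degree q = d.

Lemma W_normalizable_contract d n Θ A Γ D :
  W_normalizable d (Θ ++ copies (S n) [A] ++ Γ) D ->
  W_normalizable d (Θ ++ A :: Γ) D.
Proof.
  induction n as [|n IH]; [easy|].
  intros (q & Hq & Hd). apply IH. exists (@W V Θ A (copies n [A] ++ Γ) D q).
  split; [now apply W_normal_W|exact Hd].
Qed.

Lemma W_normalizable_contract_all d n Θ Γ D :
  W_normalizable d (Θ ++ flat_map (fun A => copies (S n) [A]) Γ) D ->
  W_normalizable d (Θ ++ Γ) D.
Proof.
  revert Θ. induction Γ as [|A Γ IH]; intros Θ H; [exact H|].
  apply W_normalizable_contract in H.
  specialize (IH (Θ ++ [A])). rewrite <- !app_assoc in IH. now apply IH.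
Qed.

End Normalization.

Theorem theorem5p5 (V : Type) (s : sequent V) (p : proof s) :
  exists q : proof s, W_normal q /\ degree q = degree p.
Proof.
  destruct (derivable_copies p) as ([|n] & Hn & H); [inversion Hn|].
  eapply derivable_perm in H; [|apply copies_flat_map].
  apply derivable_exact_degree in H as (q & Hq & Hd).
  destruct s as [Γ D].
  apply (@W_normalizable_contract_all _ _ n [] Γ).
  exists q. split; [now apply W_normal_confined|exact Hd].
Qed.
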